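(* Suppose $U$ is a strictly positive rational, $\mu=\frac U2$, and $b=1$. Then $$\lim_{T\to\infty}\frac{\mathrm{Opt}^T_{\mathbf{MAR}}(\mu,U,b)}{\mathrm{Opt}^T_{\mathbf{IND}}(\mu,U,b)}=\frac12.$$
   Context: For each integer $T\ge1$ (empty products equal 1): for integers $j\in[-1,T-1]$, $A^T_j=U\prod_{k=j+1}^{T-1}\frac{k}{b+k}$, and $A^T_T=\frac{b+T}{T}U$; for $j\in[-1,T]$, $B^T_j=\frac{j}{b+T}A^T_j$; for $j\in[0,T]$, $G^T_j(x,\mu)=\big(T-\frac{b+T}{A^T_j}\mu\big)x+(T-j)b\mu$. For $\mu>0$, $\Gamma^T_\mu=j+1$ if $\mu\in(A^{T+1}_j,A^{T+1}_{j+1}]$, $j\in[-1,T-1]$. $\beta^T_\mu=B^T_{\Gamma^T_\mu}$ and $\mathrm{Opt}^T_{\mathbf{MAR}}(\mu,U,b)=G^T_{\Gamma^T_\mu}(\beta^T_\mu,\mu)$ (the optimal value, for small initial inventory, of the $T$-period minimax newsvendor problem with martingale demand of mean $\mu$ supported in $[0,U]\cap\mathbb Q$). $\mathrm{Opt}^T_{\mathbf{IND}}(\mu,U,b)=Tb\mu$ if $\mu\le\frac{U}{b+1}$ and $=T(U-\mu)$ if $\mu>\frac{U}{b+1}$ (the corresponding value for independent demands). *)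

(* Defs.v *)
From mathcomp Require Import all_boot all_order all_algebra.
From mathcomp Require Import all_classical all_reals all_analysis.
From mathcomp Require Import zify.

Set Implicit Arguments.
Unset Strict Implicit.
Unset Printing Implicit Defensive.

Import Order.TTheory GRing.Theory Num.Theory.
Import numFieldNormedType.Exports.

Local Open Scope ring_scope.

(* The index j ranges over [-1, T], hence is an [int].  The factors with
   j + 1 <= k <= T - 1 are the natural numbers k < T with j < k, since j >= -1;
   for j = -1 the factor k = 0 makes the product vanish. *)
Definition coefA (R : realType) (U b : R) (T : nat) (j : int) : R :=
  if j == T%:Z then (b + T%:R) / T%:R * U
  else U * \prod_(0 <= k < T | j < k%:Z) (k%:R / (b + k%:R)).

Definition coefB (R : realType) (U b : R) (T : nat) (j : int) : R :=
  j%:~R / (b + T%:R) * coefA U b T j.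

Definition valG (R : realType) (U b : R) (T : nat) (j : int) (x mu : R) : R :=
  (T%:R - (b + T%:R) / coefA U b T j * mu) * x + (T%:R - j%:~R) * b * mu.

(* Here i stands for j + 1, with j in [-1, T - 1].  For 0 < b and 0 < mu <= U
   exactly one i qualifies (lemma [GammaP]); the default 0 is only
   reached outside that range. *)
Definition Gamma (R : realType) (U b : R) (T : nat) (mu : R) : nat :=
  if [pick i : 'I_T.+1 |
       coefA U b T.+1 (i%:Z - 1) < mu <= coefA U b T.+1 i%:Z] is Some i
  then i else 0%N.

Definition beta (R : realType) (U b : R) (T : nat) (mu : R) : R :=
  coefB U b T (Gamma U b T mu)%:Z.

Definition OptMAR (R : realType) (T : nat) (mu U b : R) : R :=
  valG U b T (Gamma U b T mu)%:Z (beta U b T mu) mu.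

Definition OptIND (R : realType) (T : nat) (mu U b : R) : R :=
  if mu <= U / (b + 1) then T%:R * b * mu else T%:R * (U - mu).

Lemma coefA_ge0 (R : realType) (U b : R) (T : nat) (j : int) :
  0 < b -> 0 < U -> 0 <= coefA U b T j.
Proof.
move=> b0 U0; rewrite /coefA; case: ifP => _.
  by rewrite mulr_ge0 ?divr_ge0 ?addr_ge0 ?ler0n // ltW.
rewrite mulr_ge0 ?(ltW U0) //; apply: prodr_ge0 => k _.
by rewrite divr_ge0 ?addr_ge0 ?ler0n // ltW.
Qed.

Lemma coefA_step (R : realType) (U b : R) (T i : nat) : 0 < b -> 0 < U ->
  (i <= T)%N ->
  coefA U b T.+1 (i%:Z - 1) = i%:R / (b + i%:R) * coefA U b T.+1 i%:Z.
Proof.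
move=> b0 U0 iT; rewrite /coefA.
have -> : (i%:Z - 1 == T.+1%:Z) = false by apply/eqP; lia.
have -> : (i%:Z == T.+1%:Z) = false by apply/eqP; lia.
rewrite mulrCA; congr (_ * _); rewrite !big_mkord.
have iT1 : (i < T.+1)%N by [].
rewrite (bigD1 (Ordinal iT1)) /=; last by lia.
congr (_ * _); apply: eq_bigl => k; rewrite -val_eqE /=; lia.
Qed.

Lemma coefA_homo (R : realType) (U b : R) (T i j : nat) : 0 < b -> 0 < U ->
  (i <= j)%N -> (j <= T)%N -> coefA U b T.+1 i%:Z <= coefA U b T.+1 j%:Z.
Proof.
move=> b0 U0; elim: j => [|j IH]; first by rewrite leqn0 => /eqP ->.
rewrite leq_eqVlt => /predU1P[-> //|ij jT].
apply: (le_trans (IH ij (ltnW jT))).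
have := coefA_step b0 U0 jT.
have -> : j.+1%:Z - 1 = j%:Z by lia.
move=> ->; rewrite ler_piMl ?coefA_ge0 //.
by rewrite ler_pdivrMr ?mul1r ?lerDr ?ltW // ltr_wpDr.
Qed.

Lemma GammaP (R : realType) (U b : R) (T : nat) (mu : R) (i : nat) :
  0 < b -> 0 < mu <= U -> (i <= T)%N ->
  (Gamma U b T mu = i) <->
  (coefA U b T.+1 (i%:Z - 1) < mu <= coefA U b T.+1 i%:Z).
Proof.
move=> b0 /andP[mu0 muU] iT; have U0 := lt_le_trans mu0 muU.
have uniq (p q : nat) : (p <= T)%N -> (q <= T)%N ->
    mu <= coefA U b T.+1 p%:Z -> coefA U b T.+1 (q%:Z - 1) < mu -> (q <= p)%N.
  move=> pT qT h1 h2; rewrite leqNgt; apply/negP => pq.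
  case: q qT h2 pq => // q qT; have -> : q.+1%:Z - 1 = q%:Z by lia.
  move=> h2 pq; have := @coefA_homo R U b T p q b0 U0 pq (ltnW qT).
  by rewrite leNgt (lt_le_trans h2 h1).
rewrite /Gamma; case: pickP => [k /andP[k1 k2]|none].
  split=> [<-|/andP[i1 i2]]; first by rewrite k1 k2.
  have kT : (k <= T)%N by rewrite -ltnS.
  by apply/eqP; rewrite eqn_leq !(uniq _ _ _ _ k2 i1, uniq _ _ _ _ i2 k1).
exfalso.
have AT : coefA U b T.+1 T%:Z = U.
  rewrite /coefA; have -> : (T%:Z == T.+1%:Z) = false by apply/eqP; lia.
  rewrite big_mkord big1 ?mulr1 // => k; have := ltn_ord k; lia.
have ex : exists p, mu <= coefA U b T.+1 p%:Z by exists T; rewrite AT.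
case: (ex_minnP ex) => p p1 pmin.
have pT : (p < T.+1)%N by rewrite ltnS pmin // AT.
have := none (Ordinal pT); rewrite /= p1 andbT => /negbT; rewrite -leNgt.
case: p {p1} pmin pT => [|p] pmin pT.
  by rewrite coefA_step // mul0r mul0r leNgt mu0.
have -> : p.+1%:Z - 1 = p%:Z by lia.
by move=> /pmin; rewrite ltnn.
Qed.

(* Main.v *)
Require Import Defs.
From mathcomp Require Import all_boot all_order all_algebra.
From mathcomp Require Import all_classical all_reals all_analysis.
From mathcomp Require Import zify ring lra.

(** For [b = 1] the products defining [coefA] telescope: the thresholds
    $A^{T+1}_i$ are the equally spaced points $U (i + 1) / (T + 1)$
    ([coefA_unit]).  The mean $U / 2$ sits in the middle of [0, U], so its index
    is $i = \lfloor T / 2 \rfloor$ ([Gamma_half]).  Substituting, the martingale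
    value is $U (i (i + 1) / (T + 1) - i + T / 2)$, while the independent value
    is $T U / 2$.  For $T = 2 i$ and for $T = 2 i + 1$ alike the ratio simplifies
    to $(i + 1) / (2 i + 1)$ ([OptMAR_OptIND_ratio]), that is
    $1/2 + 1 / (2 (2 i + 1))$; since $2 i + 1 \ge T$ the excess over $1/2$ lies
    between $0$ and $1 / (T + 1)$, and squeezing gives the limit. *)

Import Order.TTheory GRing.Theory Num.Theory.
Import numFieldNormedType.Exports.

Local Open Scope classical_set_scope.
Local Open Scope ring_scope.

(** The recursion [coefA_step] is run downwards from $A^{T+1}_T = U$, the empty
    product: each step multiplies by $i / (i + 1)$. *)
Lemma coefA_unit (R : realType) (U : R) (T i : nat) : 0 < U -> (i <= T)%N ->
  coefA U 1 T.+1 i%:Z = U * i.+1%:R / T.+1%:R.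
Proof.
move=> U0 iT; rewrite -(subKn iT); move: (T - i)%N (leq_subr i T) => d.
elim: d => [|d IH] dT.
  rewrite subn0 mulfK ?pnatr_eq0 // /coefA.
  have -> : (T%:Z == T.+1%:Z) = false by apply/eqP; lia.
  rewrite big_mkord big1 ?mulr1 // => k; have := ltn_ord k; lia.
have step := @coefA_step R U 1 T (T - d) ltr01 U0 (leq_subr _ _).
have pred_idx : (T - d)%:Z - 1 = (T - d.+1)%:Z by lia.
rewrite pred_idx IH 1?ltnW // in step.
have -> : (T - d.+1).+1 = (T - d)%N by lia.
rewrite step nat1r.
by field; rewrite !nat1r !pnatr_eq0.
Qed.

(** Here $T + 1$ is the number of cells of width $U / (T + 1)$, and
    $i = \lfloor T / 2 \rfloor$ is the one index with
    $2 i < T + 1 \le 2 (i + 1)$. *)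
Lemma Gamma_half (R : realType) (U : R) (T : nat) : 0 < U ->
  Gamma U 1 T (U / 2) = T./2.
Proof.
move=> U0; have iT : (T./2 <= T)%N by lia.
apply/GammaP => //; first by apply/andP; split; lra.
rewrite coefA_step // coefA_unit // nat1r.
have -> : T./2%:R / T./2.+1%:R * (U * T./2.+1%:R / T.+1%:R)
          = U * (T./2%:R / T.+1%:R) :> R.
  by field; rewrite !nat1r !pnatr_eq0.
rewrite -mulrA ltr_pM2l // ler_pM2l //.
rewrite ltr_pdivrMr ?ltr0n // ler_pdivlMr ?ltr0n //.
rewrite ltr_pdivlMl // ler_pdivrMl // -!natrM ltr_nat ler_nat.
by apply/andP; split; lia.
Qed.

Lemma OptMAR_OptIND_ratio (R : realType) (U : R) (T : nat) :
  0 < U -> (0 < T)%N ->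
  OptMAR T (U / 2) U 1 / OptIND T (U / 2) U 1
    = T./2.+1%:R / (T./2).*2.+1%:R.
Proof.
case: T => // n U0 _; have U_neq0 : U != 0 by rewrite gt_eqF.
rewrite /OptMAR /OptIND /beta /valG /Defs.coefB Gamma_half //.
rewrite coefA_unit //; last by lia.
rewrite lexx mulr1 -pmulrn.
(* The two parities of T are the two ways of expressing T through i. *)
have [] : n.+1 = (n.+1./2).*2.+1 \/ n.+1 = (n.+1./2).*2 by lia.
all: move: n.+1./2 => i ni.
- have -> : n = i.*2 by lia.
  rewrite -!muln2 -!natr1 !natrM.
  have i_ge0 := ler0n R i.
  by field; rewrite U_neq0 /=; repeat (apply/andP; split); apply: lt0r_neq0; lra.
- case: i ni => // k nk; have -> : n = k.*2.+1 by lia.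
  rewrite -!muln2 -!natr1 !natrM -!natr1.
  have k_ge0 := ler0n R k.
  by field; rewrite U_neq0 /=; repeat (apply/andP; split); apply: lt0r_neq0; lra.
Qed.

Theorem corollary3 (R : realType) (q : rat) (U mu b : R)
  (hq : 0 < q) (hU : U = ratr q) (hmu : mu = U / 2) (hb : b = 1) :
  OptMAR T mu U b / OptIND T mu U b @[T --> \oo] --> (1 / 2 : R).
Proof.
have U0 : 0 < U by rewrite hU ltr0q.
rewrite hmu hb.
apply: (@squeeze_cvgr _ _ _ _ (fun=> 1 / 2) (fun T => 1 / 2 + harmonic T)).
- near=> T.
  (* At T = 0 the quotient is 0 / 0 = 0, below the lower bound. *)
  have T0 : (0 < T)%N by near: T; exact: nbhs_infty_gt.
  rewrite OptMAR_OptIND_ratio //= ler_pdivlMr ?ltr0n //.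
  have den_gt0 : (0 : R) < (T./2).*2.+1%:R by rewrite ltr0n.
  apply/andP; split; first by rewrite -muln2 -[(_ * 2).+1%:R]natr1 -[T./2.+1%:R]natr1 natrM; lra.
  have -> : T./2.+1%:R / (T./2).*2.+1%:R
            = 1 / 2 + (2 * (T./2).*2.+1%:R)^-1 :> R.
    rewrite -muln2 -!natr1 natrM; have i_ge0 := ler0n R T./2.
    by field; apply: lt0r_neq0; lra.
  rewrite lerD2l lef_pV2 ?posrE ?mulr_gt0 ?ltr0n //.
  by rewrite -natrM ler_nat; lia.
- exact: cvg_cst.
- rewrite -[X in _ --> X]addr0; apply: cvgD; first exact: cvg_cst.
  exact: cvg_harmonic.
Unshelve. all: by end_near.
Qed.
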